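(* Let $B \neq C$ be points and let $A, A'$ be points on the same side of the line through $B$ and $C$. If $AB \cong A'B$ and $AC \cong A'C$, then $A' = A$.
   Context: Setting. A plane consists of a set of points, a family of lines (sets of points), a (strict) betweenness relation, and a relation $\cong$ (congruence) on segments, with the following assumptions. Incidence: two distinct points lie on exactly one line; every line has at least two points; there exist three non-collinear points. Order: the points of each line carry a pair of mutually opposite total orders, and $C$ lies between $A$ and $B$ iff it lies strictly between them on their common line for these orders. For $A \ne B$, the segment $AB = BA$ consists of $A$, $B$ and all points between them; between any two distinct points there is another point; every segment can be extended beyond either end. A point $O$ of a line divides the line into two opposite rays based at $O$ having only $O$ in common; $\overrightarrow{OA}$ denotes the ray based at $O$ containing $A\neq O$. Plane separation: each line $l$ partitions the points not on $l$ into two nonempty classes (the sides of $l$); each side is convex (contains the segment $AB$ whenever it contains $A$ and $B$), and a segment with ends on different sides of $l$ meets $l$. Congruence: $\cong$ is an equivalence relation on (undirected) segments. For every segment $AB$ and every ray based at a point $O$ there is a unique point $X \neq O$ on that ray with $OX \cong AB$. Addition and subtraction of segments: let $B$ lie between $A$ and $C$, and $B'$ between $A'$ and $C'$. If two of $AB \cong A'B'$, $BC \cong B'C'$, $AC \cong A'C'$ hold, so does the third. Every segment $BC$ has a midpoint (a point $M$ between $B$ and $C$ with $MB\cong MC$). Axiom T: if $A,B,C$ are non-collinear points and $A'B' \cong AB$, where $A'$ and $B'$ lie on a line $l$, then on either side of $l$ there is a point $C'$ with $A'C' \cong AC$ and $B'C' \cong BC$. Angles: an angle is a pair of rays, not lying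 on a common line, with the same base point (its vertex); $\angle XMY$ has rays $\overrightarrow{MX}$, $\overrightarrow{MY}$. If $A,B,C$ are non-collinear with $AB \cong AC$ and $M$ is the midpoint of $BC$, then $\angle AMB$ and $\angle AMC$ are called paired right angles at $M$. A right angle is an angle that is a member of some such pair. Axiom R1: if $\angle BAC$ and $\angle EDF$ are right angles with $AB \cong DE$ and $AC \cong DF$, then $BC \cong EF$. Axiom R2: at most one angle of a triangle (three non-collinear points) is a right angle. *)

(* Defs.v *)
From mathcomp Require Import all_boot.
From mathcomp Require Import boolp classical_sets.

Set Implicit Arguments.
Unset Strict Implicit.
Unset Printing Implicit Defensive.

Local Open Scope classical_set_scope.

(* [between A C B] reads "C lies between A and B" (middle argument in the
   middle).  [cong] relates point sets; the axioms confine it to segments. *)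
Record plane_data := PlaneData {
  plane_pt :> Type;
  is_line : set plane_pt -> Prop;
  between : plane_pt -> plane_pt -> plane_pt -> Prop;
  cong : set plane_pt -> set plane_pt -> Prop
}.

Section Notions.
Variable P : plane_data.
Implicit Types (A B C M O X Y : P) (l r s S : set P).

Definition collinear A B C : Prop :=
  exists l, [/\ is_line l, l A, l B & l C].

(* [le] is one of the two opposite orders carried by the line [l]; the other
   one is its converse, which satisfies this predicate as well. Only the
   restriction of [le] to [l] matters. *)
Definition line_order l (le : P -> P -> Prop) : Prop :=
  [/\ forall X, l X -> le X X,
      forall X Y, l X -> l Y -> le X Y -> le Y X -> X = Y,
      forall X Y Z, l X -> l Y -> l Z -> le X Y -> le Y Z -> le X Z,
      forall X Y, l X -> l Y -> le X Y \/ le Y X &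
      let lt X Y := le X Y /\ X <> Y in
      forall A B C, l A -> l B ->
        (between A C B <-> l C /\ ((lt A C /\ lt C B) \/ (lt B C /\ lt C A)))].

(* The segment with ends A and B; meant for A <> B, see [is_segment]. *)
Definition seg A B : set P := [set X | X = A \/ X = B \/ between A X B].

Definition is_segment s : Prop := exists A B, A <> B /\ s = seg A B.

(* The two opposite rays into which O divides a line are the two final
   segments {X | O <= X}, one for each of the two orders of the line. *)
Definition is_ray O r : Prop :=
  exists l le,
    [/\ is_line l, l O, line_order l le & r = [set X | l X /\ le O X]].

(* The ray based at O containing A, for A <> O (there is only one). *)
Definition ray O A : set P :=
  [set X | exists r, [/\ is_ray O r, r A & r X]].

Definition convex S : Prop := forall A B, S A -> S B -> seg A B `<=` S.

Definition separates l S S' : Prop :=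
  [/\ S `|` S' = ~` l /\ S `&` S' = set0,
      S !=set0 /\ S' !=set0,
      convex S /\ convex S' &
      forall A B, S A -> S' B -> seg A B `&` l !=set0].

Definition is_side l S : Prop := exists S', separates l S S'.

Definition same_side l A B : Prop := exists S, [/\ is_side l S, S A & S B].

Definition is_midpoint M B C : Prop :=
  between B M C /\ cong (seg M B) (seg M C).

(* Unordered pair of rays; used only when X, M, Y are not collinear. *)
Definition angle X M Y : set (set P) := [set ray M X; ray M Y].

Definition paired_right_angles (a b : set (set P)) : Prop :=
  exists A B C M,
    [/\ ~ collinear A B C, cong (seg A B) (seg A C), is_midpoint M B C,
        a = angle A M B & b = angle A M C].

Definition right_angle (a : set (set P)) : Prop :=
  exists b, paired_right_angles a b \/ paired_right_angles b a.

Definition incidence_axioms : Prop :=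
  [/\ forall A B, A <> B -> exists! l, [/\ is_line l, l A & l B],
      forall l, is_line l -> exists A B, [/\ A <> B, l A & l B] &
      exists A B C, ~ collinear A B C].

Definition order_axioms : Prop :=
  [/\ forall l, is_line l -> exists le, line_order l le,
      forall A B, A <> B -> exists C, between A C B &
      forall A B, A <> B -> exists C, between A B C].

Definition separation_axiom : Prop :=
  forall l, is_line l -> exists S S', separates l S S'.

Definition cong_equivalence : Prop :=
  [/\ forall s t, cong s t -> is_segment s /\ is_segment t,
      forall s, is_segment s -> cong s s,
      forall s t, cong s t -> cong t s &
      forall s t u, cong s t -> cong t u -> cong s u].

Definition segment_transport : Prop :=
  forall A B O r, A <> B -> is_ray O r ->
    exists! X, [/\ r X, X <> O & cong (seg O X) (seg A B)].

Definition segment_arithmetic : Prop :=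
  forall A B C A' B' C', between A B C -> between A' B' C' ->
    let ab := cong (seg A B) (seg A' B') in
    let bc := cong (seg B C) (seg B' C') in
    let ac := cong (seg A C) (seg A' C') in
    [/\ ab -> bc -> ac, ab -> ac -> bc & bc -> ac -> ab].

Definition midpoint_axiom : Prop :=
  forall B C, B <> C -> exists M, is_midpoint M B C.

Definition axiom_T : Prop :=
  forall A B C A' B' l S, ~ collinear A B C ->
    is_line l -> l A' -> l B' -> cong (seg A' B') (seg A B) ->
    is_side l S ->
    exists C', [/\ S C', cong (seg A' C') (seg A C)
                 & cong (seg B' C') (seg B C)].

Definition axiom_R1 : Prop :=
  forall A B C D E F,
    right_angle (angle B A C) -> right_angle (angle E D F) ->
    cong (seg A B) (seg D E) -> cong (seg A C) (seg D F) ->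
    cong (seg B C) (seg E F).

(* Any two of the three angles of a triangle are of this form after renaming
   its vertices. *)
Definition axiom_R2 : Prop :=
  forall A B C, ~ collinear A B C ->
    ~ (right_angle (angle B A C) /\ right_angle (angle A B C)).

Record is_plane : Prop := IsPlane {
  plane_incidence : incidence_axioms;
  plane_order : order_axioms;
  plane_separation : separation_axiom;
  plane_cong_equivalence : cong_equivalence;
  plane_segment_transport : segment_transport;
  plane_segment_arithmetic : segment_arithmetic;
  plane_midpoint : midpoint_axiom;
  plane_T : axiom_T;
  plane_R1 : axiom_R1;
  plane_R2 : axiom_R2
}.

End Notions.

(* Main.v *)
Require Import Defs.
From mathcomp Require Import all_boot.
From mathcomp Require Import boolp classical_sets.

(** If A and A' were distinct, both B and C would be equidistant from A and A'.
    Neither is on the line AA', because segments of a given length are unique on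
    a ray ([same_side_equidistant_off_line]); hence B and C would be the apexes
    of two isosceles triangles over the base AA'.  With
    M the midpoint of AA', the angles at M between AA' and MB, MC are then right.
    Everything rests on the uniqueness of the perpendicular at M: it puts M on
    the line BC, whereas M lies between A and A', two points on the same side of
    that line.

    Uniqueness of the perpendicular is first obtained for two points B and Z on
    opposite sides of AA' ([opposite_equidistant_collinear]).  Slide Z along its
    ray until MZ is congruent to MB, and let Q be the point where BZ crosses the
    line AA'.  If Q differs from M, then R1 applied to the right triangles QMB
    and QMZ makes Q the midpoint of BZ; now MBZ is isosceles, so the angle MQB is
    right, and the triangle BMQ has right angles at both M and Q, against R2.
    Hence Q = M.  Two points B and C on the same side of AA' are compared through
    a third equidistant point on the other side, which axiom T supplies
    ([equidistant_collinear]). *)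

Set Implicit Arguments.
Unset Strict Implicit.

Section Plane.
Local Open Scope classical_set_scope.
Variables (P : plane_data) (hP : is_plane P).
Implicit Types (A B C M O Q X Y Z : P) (l m r s S : set P).

(** * Lines, segments and betweenness *)

Lemma line_through A B : A <> B -> exists l, [/\ is_line l, l A & l B].
Proof.
by move=> AB; have [+ _ _] := plane_incidence hP => /(_ A B AB) [l [? _]]; exists l.
Qed.

Lemma line_unique l m A B : A <> B -> is_line l -> l A -> l B ->
  is_line m -> m A -> m B -> l = m.
Proof.
move=> AB hl lA lB hm mA mB.
have [+ _ _] := plane_incidence hP => /(_ A B AB) [k [_ uk]].
by rewrite -(uk l) // -(uk m).
Qed.

Lemma collinear_line l A B C : A <> B -> is_line l -> l A -> l B ->
  collinear A B C -> l C.
Proof.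
by move=> AB hl lA lB [m [hm mA mB mC]]; rewrite (@line_unique l m A B).
Qed.

Lemma line_has_order l : is_line l -> exists le, line_order l le.
Proof. by have [+ _ _] := plane_order hP => /(_ l). Qed.

Lemma line_order_rev l le : line_order l le -> line_order l (fun X Y => le Y X).
Proof.
case=> re an tr to be; split=> //.
- by move=> X Y lX lY XY YX; apply: an.
- by move=> X Y Z lX lY lZ XY YZ; apply: (tr Z Y X).
- by move=> X Y lX lY; case: (to X Y lX lY); [right|left].
- move=> lt A B C lA lB; rewrite be //.
  have E X Y : lt X Y <-> le Y X /\ Y <> X.
    by rewrite /lt; split=> -[? N]; split=> // /esym.
  split=> -[lC H]; split=> //; move: H; rewrite !E; tauto.
Qed.

Lemma between_on l A B C : is_line l -> l A -> l C -> between A B C ->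
  [/\ l B, A <> B, C <> B, A <> C & between C B A].
Proof.
move=> hl lA lC; have [le [re an tr to be]] := line_has_order hl.
rewrite be // => -[lB H]; split=> //.
- by case: H => -[[_ h1] [_ h2]] // /esym.
- by case: H => -[[_ h1] [_ h2]] // /esym.
- by move=> AC; subst C; case: H => -[[h1 n1] [h2 _]]; apply: n1; apply: an.
- by rewrite be //; split=> //; case: H; [right|left].
Qed.

Lemma seg_sym A B : A <> B -> seg A B = seg B A.
Proof.
move=> AB; have [l [hl lA lB]] := line_through AB.
apply/seteqP; split=> X [->|[->|H]]; rewrite /seg /=; try tauto.
- by right; right; case: (between_on hl lA lB H).
- by right; right; case: (between_on hl lB lA H).
Qed.

Lemma cong_refl A B : A <> B -> cong (seg A B) (seg A B).
Proof.
by move=> AB; have [_ + _ _] := plane_cong_equivalence hP; apply; exists A, B.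
Qed.

Lemma cong_sym s s' : cong s s' -> cong s' s.
Proof. by have [_ _ + _] := plane_cong_equivalence hP; apply. Qed.

Lemma cong_trans s s' s'' : cong s s' -> cong s' s'' -> cong s s''.
Proof. by have [_ _ _ +] := plane_cong_equivalence hP; apply. Qed.

(** * Rays *)

Lemma ray_exists O A : A <> O -> exists2 r, is_ray O r & r A.
Proof.
move=> AO; have [l [hl lA lO]] := line_through AO.
have [le hle] := line_has_order hl.
have [_ _ _ to _] := hle.
case: (to O A lO lA) => H.
- by exists [set X | l X /\ le O X] => //; exists l, le.
- exists [set X | l X /\ le X O] => //; exists l, (fun X Y => le Y X).
  by split=> //; apply: line_order_rev.
Qed.

(** Rays are defined from an order of their line; this description by
    betweenness does not mention the order, which makes the ray through a given
    point unique. *)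
Lemma in_rayE O r A X : is_ray O r -> r A -> A <> O ->
  r X <-> collinear O A X /\ ~ between A O X.
Proof.
move=> [l [le [hl lO [re an tr to be] ->]]] /= [lA OA] AO; split.
- move=> [lX OX]; split; first by exists l.
  by rewrite be // => -[_ []] [[h1 n1] _]; apply: n1; apply: an.
- move=> [co nb]; have lX : l X by apply: collinear_line co => // /esym.
  split=> //; case: (to O X lO lX) => // XO.
  have [->|nXO] := pselect (X = O); first exact: re.
  by exfalso; apply: nb; rewrite be //; split=> //; right; do 2![split=> //] => /esym.
Qed.

Lemma rayE O r A : is_ray O r -> r A -> A <> O -> ray O A = r.
Proof.
move=> hr rA AO; apply/seteqP; split=> X.
- by move=> [r' [hr' r'A r'X]]; apply/(in_rayE X hr rA AO)/(in_rayE X hr' r'A AO).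
- by move=> rX; exists r.
Qed.

Lemma same_ray O r A X : is_ray O r -> r A -> r X -> A <> O -> X <> O ->
  ray O A = ray O X.
Proof. by move=> hr rA rX AO XO; rewrite (rayE hr rA AO) (rayE hr rX XO). Qed.

Lemma between_or_same_ray l O A X : is_line l -> l O -> l A -> l X ->
  A <> O -> X <> O -> between A O X \/ ray O A = ray O X.
Proof.
move=> hl lO lA lX AO XO; have [|nb] := pselect (between A O X); first by left.
right; have [r hr rA] := ray_exists AO; apply: (same_ray hr) => //.
by apply/(in_rayE X hr rA AO); split=> //; exists l.
Qed.

Lemma ray_of_two l O A A' X : is_line l -> l A -> l A' -> between A O A' ->
  l X -> X <> O -> ray O X = ray O A \/ ray O X = ray O A'.
Proof.
move=> hl lA lA' b lX XO.
have [lO AO A'O _ _] := between_on hl lA lA' b.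
case: (between_or_same_ray hl lO lA lX AO XO) => [b1|->]; last by left.
right; apply/esym.
case: (between_or_same_ray hl lO lA' lX A'O XO) => // b2; exfalso.
(* Otherwise O would separate each two of the three points A, A', X, although
   two of them come on the same side of O in the order of the line. *)
have [le [re an tr to be]] := line_has_order hl.
have anA := an A O lA lO; have anA' := an A' O lA' lO; have anX := an X O lX lO.
by move: b b1 b2; rewrite !be //; tauto.
Qed.

Lemma segment_on_ray_unique O r A X : is_ray O r -> r A -> r X ->
  A <> O -> X <> O -> cong (seg O A) (seg O X) -> A = X.
Proof.
move=> hr rA rX AO XO c.
have OX : O <> X by move/esym.
have [Y [_ uY]] := plane_segment_transport hP OX hr.
rewrite -(uY A); last by split.
by rewrite -(uY X); last by split=> //; apply: cong_refl.
Qed.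

(** * Sides of a line *)

Lemma separates_sym l S S' : separates l S S' -> separates l S' S.
Proof.
move=> [[u i] [n n'] [c c'] x]; split=> //.
- by rewrite setUC setIC.
- move=> A B S'A SB; have AB : A <> B.
    by move=> E; subst B; have : (S `&` S') A by []; rewrite i.
  by rewrite seg_sym //; apply: x.
Qed.

Lemma side_off_line l S S' A : separates l S S' -> S A -> ~ l A.
Proof. by move=> [[u _] _ _ _] SA; have : (S `|` S') A by [left]; rewrite u. Qed.

Lemma separates_neq l S S' A B : separates l S S' -> S A -> S' B -> A <> B.
Proof.
by move=> [[_ i] _ _ _] SA S'B E; subst B; have : (S `&` S') A by []; rewrite i.
Qed.

Lemma off_line_side l S S' A : separates l S S' -> ~ l A -> S A \/ S' A.
Proof. by move=> [[u _] _ _ _] nA; have : (~` l) A by []; rewrite -u. Qed.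

Lemma separates_meet l S S' A B : separates l S S' -> S A -> S' B ->
  exists2 Q, l Q & between A Q B.
Proof.
move=> sep SA S'B; have [_ _ _ /(_ A B SA S'B) [Q [H lQ]]] := sep.
exists Q => //; case: H => [E|[E|//]]; subst Q.
- by case: (side_off_line sep SA).
- by case: (side_off_line (separates_sym sep) S'B).
Qed.

Lemma same_side_not_between l A B Q : same_side l A B -> l Q -> ~ between A Q B.
Proof.
move=> [S [[S' sep] SA SB]] lQ b; have [_ _ [cS _] _] := sep.
by apply: (side_off_line sep) lQ; apply: (cS A B) => //; right; right.
Qed.

(** The line of the ray meets l only in O, and O is not between two points of the
    ray: no segment joining two such points can reach l. *)
Lemma ray_in_side l S S' O r A X : is_line l -> separates l S S' -> l O ->
  is_ray O r -> r A -> S A -> r X -> X <> O -> S X.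
Proof.
move=> hl sep lO hr rA SA rX XO.
have nA := side_off_line sep SA.
have AO : A <> O by move=> E; subst A.
have [[m [hm mO mA mX]] nb] : collinear O A X /\ ~ between A O X.
  exact/(in_rayE X hr rA AO).
have meet Q : m Q -> l Q -> Q = O.
  move=> mQ lQ; apply: contrapT => QO; apply: nA.
  by rewrite (line_unique QO hl lQ lO hm mQ mO).
have nX : ~ l X by move=> lX; apply: XO; apply: meet.
case: (off_line_side sep nX) => // S'X.
have [Q lQ bQ] := separates_meet sep SA S'X.
have [mQ _ _ _ _] := between_on hm mA mX bQ.
by case: nb; rewrite -(meet Q).
Qed.

(** * Perpendiculars *)

Lemma angle_sym X M Y : angle X M Y = angle Y M X.
Proof. exact: setUC. Qed.

Lemma isosceles_right A B C M : ~ collinear A B C ->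
  cong (seg A B) (seg A C) -> is_midpoint M B C ->
  right_angle (angle A M B) /\ right_angle (angle A M C).
Proof.
move=> nc c mi; split.
- by exists (angle A M C); left; exists A, B, C, M.
- by exists (angle A M B); right; exists A, B, C, M.
Qed.

(** An angle depends only on its rays, and every point of the base line other
    than M is on the ray MB or on the ray MC. *)
Lemma isosceles_right_on_base l A B C M Q : ~ collinear A B C ->
  cong (seg A B) (seg A C) -> is_midpoint M B C -> is_line l -> l B -> l C ->
  l Q -> Q <> M -> right_angle (angle A M Q).
Proof.
move=> nc c mi hl lB lC lQ QM; have [rB rC] := isosceles_right nc c mi.
by have [|] := ray_of_two hl lB lC (proj1 mi) lQ QM; rewrite /angle => ->.
Qed.

Lemma noncollinear_off_line l A B C : is_line l -> l B -> l C -> B <> C ->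
  ~ l A -> ~ collinear A B C.
Proof.
move=> hl lB lC BC nA [m [hm mA mB mC]].
by apply: nA; rewrite (line_unique BC hl lB lC hm).
Qed.

(** Two perpendiculars to AA' at M pointing to opposite sides are in line: a
    deviation would produce a triangle with two right angles. *)
Lemma opposite_equidistant_collinear l S S' A A' M B Z :
  is_line l -> separates l S S' -> l A -> l A' -> is_midpoint M A A' ->
  S B -> S' Z -> cong (seg B A) (seg B A') -> cong (seg Z A) (seg Z A') ->
  collinear B M Z.
Proof.
move=> hl sep lA lA' mi SB S'Z cB cZ.
have sep' := separates_sym sep.
have [lM _ _ AA' _] := between_on hl lA lA' (proj1 mi).
have nB := side_off_line sep SB.
have nZ := side_off_line sep' S'Z.
have MB : M <> B by move=> E; subst B.
have ZM : Z <> M by move=> E; subst Z.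
have [r hr rZ] := ray_exists ZM.
have [X [[rX XM cX] _]] := plane_segment_transport hP MB hr.
have S'X : S' X := ray_in_side hl sep' lM hr rZ S'Z rX XM.
have nX := side_off_line sep' S'X.
have BX : B <> X := separates_neq sep SB S'X.
have [Q lQ bQ] := separates_meet sep SB S'X.
have [k [hk kB kX]] := line_through BX.
have [kQ BQ XQ _ _] := between_on hk kB kX bQ.
have [QM|QM] := pselect (Q = M).
  subst Q; exists k; split=> //.
  have [[m [hm mM mZ mX]] _] := proj1 (in_rayE X hr rZ ZM) rX.
  by rewrite (line_unique (nesym XM) hk kQ kX hm).
exfalso.
(* Q may be on either of the rays MA, MA'; the angles at M are right anyway. *)
have rB : right_angle (angle B M Q).
  by apply: (isosceles_right_on_base _ cB mi hl) => //; apply: noncollinear_off_line nB.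
have rX' : right_angle (angle X M Q).
  rewrite /angle -(same_ray hr rZ rX ZM XM).
  by apply: (isosceles_right_on_base _ cZ mi hl) => //; apply: noncollinear_off_line nZ.
have MQ : M <> Q by move/esym.
(* R1: the right triangles QMB and QMX have congruent legs. *)
have cQ : cong (seg Q B) (seg Q X).
  rewrite (seg_sym (nesym BQ)) (seg_sym (nesym XQ)).
  by apply: plane_R1 rB rX' _ _ => //; [exact: cong_sym|exact: cong_refl].
have nM : ~ k M.
  by move=> kM; apply: nB; rewrite (line_unique MQ hl lM lQ hk kM kQ).
have [rQ _] : right_angle (angle M Q B) /\ right_angle (angle M Q X).
  by apply: isosceles_right; [exact: noncollinear_off_line nM|exact: cong_sym|].
apply: (plane_R2 hP (A := M) (B := Q) (C := B)).
- by move=> co; apply: nB; apply: collinear_line co.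
- by split=> //; rewrite angle_sym.
Qed.

(** The points off AA' that are equidistant from A and A' lie on one line
    through M; for two of them on the same side, a third one on the other side
    serves as the common reference. *)
Lemma equidistant_collinear l A A' M B C :
  is_line l -> l A -> l A' -> is_midpoint M A A' -> ~ l B -> ~ l C ->
  cong (seg B A) (seg B A') -> cong (seg C A) (seg C A') ->
  collinear B M C.
Proof.
move=> hl lA lA' mi nB nC cB cC.
have [lM _ _ AA' _] := between_on hl lA lA' (proj1 mi).
have [S0 [S0' sep0]] := plane_separation hP hl.
have [S [S' [sep SB]]] : exists S S', separates l S S' /\ S B.
  have [SB|SB] := off_line_side sep0 nB; first by exists S0, S0'.
  by exists S0', S0; split=> //; apply: separates_sym.
have sep' := separates_sym sep.
have [SC|S'C] := off_line_side sep nC; last first.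
  exact: opposite_equidistant_collinear hl sep lA lA' mi SB S'C cB cC.
have neqA X : ~ l X -> X <> A /\ X <> A' by move=> nX; split=> E; subst X.
have [BA BA'] := neqA B nB.
have nc : ~ collinear A A' B by move=> co; apply: nB; apply: collinear_line co.
have [Z [S'Z cZA cZA']] := plane_T hP nc hl lA lA' (cong_refl AA')
  (ex_intro _ S sep').
have nZ := side_off_line sep' S'Z.
have [ZA ZA'] := neqA Z nZ.
have cZ : cong (seg Z A) (seg Z A').
  rewrite (seg_sym ZA) (seg_sym ZA'); apply: cong_trans cZA _.
  by apply: cong_trans (cong_sym cZA'); rewrite -(seg_sym BA) -(seg_sym BA').
have [k [hk kB kM kZ]] :=
  opposite_equidistant_collinear hl sep lA lA' mi SB S'Z cB cZ.
have [m [hm mC mM mZ]] :=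
  opposite_equidistant_collinear hl sep lA lA' mi SC S'Z cC cZ.
have MZ : M <> Z by move=> E; subst Z.
by exists k; split=> //; rewrite (line_unique MZ hk kM kZ hm).
Qed.

(** On a line through B, the two points at a given distance from B are on
    opposite rays, so they cannot be on the same side of a line through B. *)
Lemma same_side_equidistant_off_line l m A A' B : is_line m -> m A -> m A' ->
  A <> A' -> l B -> same_side l A A' -> cong (seg B A) (seg B A') -> ~ m B.
Proof.
move=> hm mA mA' AA' lB ss c mB.
have [S [[S' sep] SA SA']] := ss.
have AB : A <> B by move=> E; subst B; apply: (side_off_line sep SA).
have A'B : A' <> B by move=> E; subst B; apply: (side_off_line sep SA').
have [|E] := between_or_same_ray hm mB mA mA' AB A'B.
  exact: same_side_not_between ss lB.
have [r hr rA] := ray_exists AB.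
apply: AA'; apply: (segment_on_ray_unique hr rA _ AB A'B c).
have [r' hr' rA'] := ray_exists A'B.
by rewrite -(rayE hr rA AB) E (rayE hr' rA' A'B).
Qed.

End Plane.

Unset Implicit Arguments.
Set Strict Implicit.

Theorem theorem3 (P : plane_data) (hP : is_plane P) (A A' B C : P)
    (l : set P) (hBC : B <> C) (hl : is_line l) (hB : l B) (hC : l C)
    (hside : same_side l A A')
    (hAB : cong (seg A B) (seg A' B)) (hAC : cong (seg A C) (seg A' C)) :
  A' = A.
Proof.
apply: contrapT => /nesym AA'.
have [S [[S' sep] SA SA']] := hside.
have neq X Y : S X -> l Y -> X <> Y.
  by move=> SX lY E; subst Y; apply: (side_off_line sep SX).
have cB : cong (seg B A) (seg B A').
  by rewrite -(seg_sym hP (neq A B SA hB)) -(seg_sym hP (neq A' B SA' hB)).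
have cC : cong (seg C A) (seg C A').
  by rewrite -(seg_sym hP (neq A C SA hC)) -(seg_sym hP (neq A' C SA' hC)).
have [m [hm mA mA']] := line_through hP AA'.
have nB : ~ m B := same_side_equidistant_off_line hP hm mA mA' AA' hB hside cB.
have nC : ~ m C := same_side_equidistant_off_line hP hm mA mA' AA' hC hside cC.
have [M mi] := plane_midpoint hP AA'.
have [k [hk kB kM kC]] := equidistant_collinear hP hm mA mA' mi nB nC cB cC.
apply: (same_side_not_between hside _ (proj1 mi)).
by rewrite (line_unique hP hBC hl hB hC hk).
Qed.
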